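(* Let $G$ be a group definable in a first order structure $M$. (1) For the ambit $(G,S_{G,ext}(M),\mathrm{tp}_{ext}(e/M))$ all three properties WDRP, DRP, EDRP are equivalent. Similarly, for the ambit $(G,S(\mathrm{Def}(G)^d),p_e)$ all three properties WDRP, DRP, EDRP are equivalent. (2) For the ambit $(G,S_G(M),\mathrm{tp}(e/M))$ the properties WDRP and DRP are equivalent. (3) The ambit $(G,S_G(M),\mathrm{tp}(e/M))$ has EDRP if and only if the ambit $(G,S(\mathrm{Def}(G)^d),p_e)$ has EDRP.
   Context: A Boolean $G$-algebra of subsets of $G$ is a Boolean algebra of subsets of $G$ closed under left translations by elements of $G$. For such $\mathcal{A}$, $S(\mathcal{A})$ is its Stone space of ultrafilters with the left translation action of the (discrete) group $G$, and $p_e=\{A\in\mathcal{A}:e\in A\}$; $(G,S(\mathcal{A}),p_e)$ is a $0$-dimensional ambit. For $p\in S(\mathcal{A})$ and $A\in\mathcal{A}$ put $d_p(A)=\{g\in G: g^{-1}A\in p\}$; $\mathcal{A}$ is d-closed if $d_p[\mathcal{A}]\subseteq\mathcal{A}$ for every $p\in S(\mathcal{A})$. $\mathcal{A}^d$ is the smallest d-closed Boolean $G$-algebra of subsets of $G$ containing $\mathcal{A}$ (it exists, and is the Boolean algebra generated by all $d_p(A)$, $A\in\mathcal{A}$, $p\in S(\mathcal{A})$). $\mathrm{Def}(G)$ is the Boolean $G$-algebra of subsets of $G$ definable in $M$ with parameters; $S_G(M)$ is the space of complete types over $M$ concentrated on $G$, identified with $S(\mathrm{Def}(G))$, and $\mathrm{tp}(e/M)$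 corresponds to $p_e$. A subset of $G$ is externally definable if it is the trace on $G=G(M)$ of a set definable, with parameters, in an elementary extension of $M$; $S_{G,ext}(M)$ is the Stone space of the Boolean $G$-algebra of externally definable subsets of $G$, and $\mathrm{tp}_{ext}(e/M)$ is the principal ultrafilter at $e$. For a $0$-dimensional ambit $(G,X,x_0)$ (compact Hausdorff $0$-dimensional $X$ with a continuous $G$-action, $Gx_0$ dense): a coloring is a function $c\colon G\to 2^n$, $n\ge 1$. For $S\subseteq X$, $c$ is $S$-definable if there are clopen sets $U_0,\dots,U_{n-1}\subseteq X$ and points $y_0,\dots,y_{n-1}\in S$ such that for all $g\in G$, $i<n$: $c(g)(i)=1$ if $y_i\in gU_i$ and $c(g)(i)=0$ if $y_i\notin gU_i$. The ambit has $S$-DRP if for every $S$-definable coloring $c\colon G\to 2^n$, every $k\ge 1$ and every $k$-element $A\subseteq G$ there is $h\in G$ such that $|c[hA]|=1$. WDRP, DRP, EDRP mean $S$-DRP for $S=\{x_0\}$, $S=Gx_0$, $S=X$, respectively. *)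

(* Defs.v *)
From HB Require Import structures.
From mathcomp Require Import all_boot.
From mathcomp Require Import boolp classical_sets functions cardinality filter.
From mathcomp Require Import topology.
From mathcomp Require Import zify.

Set Implicit Arguments.
Unset Strict Implicit.
Unset Printing Implicit Defensive.

Local Open Scope nat_scope.
Local Open Scope classical_set_scope.

Record language := Language {
  fsym : Type;
  farity : fsym -> nat;
  rsym : Type;
  rarity : rsym -> nat
}.

Record structure (L : language) := Structure {
  carrier :> Type;
  carrier_inhabited : inhabited carrier;
  fint : forall f : fsym L, (farity f).-tuple carrier -> carrier;
  rint : forall r : rsym L, (rarity r).-tuple carrier -> Prop
}.

Inductive term (L : language) :=
| Var of nat
| App (f : fsym L) of ('I_(farity f) -> term L).

(* Variables are de Bruijn indices: [Fall] binds variable 0 of its argument. *)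
Inductive formula (L : language) :=
| Fbot
| Feq of term L & term L
| Frel (r : rsym L) of ('I_(rarity r) -> term L)
| Fimp of formula L & formula L
| Fall of formula L.

Arguments Var {L}.
Arguments App {L}.
Arguments Fbot {L}.
Arguments Frel {L}.

Definition scons T (a : T) (v : nat -> T) (i : nat) : T :=
  if i is k.+1 then v k else a.

Fixpoint eval L (M : structure L) (v : nat -> M) (t : term L) : M :=
  match t with
  | Var i => v i
  | App f a => fint [tuple eval v (a i) | i < farity f]
  end.

Fixpoint sat L (M : structure L) (v : nat -> M) (phi : formula L) : Prop :=
  match phi with
  | Fbot => False
  | Feq s t => eval v s = eval v t
  | Frel r a => rint [tuple eval v (a i) | i < rarity r]
  | Fimp phi psi => sat v phi -> sat v psi
  | Fall phi => forall a : M, sat (scons a v) phi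
  end.

(* [env s v] assigns the entries of [s] to the variables 0, ..., size s - 1
   and [v i] to the variable size s + i. *)
Definition env T (s : seq T) (v : nat -> T) (k : nat) : T :=
  nth (v (k - size s)) s k.

(* Definability is with parameters: they are the values of [v], of which only
   the finitely many that occur in [phi] matter. *)
Definition definable L (M : structure L) n (D : set (n.-tuple M)) : Prop :=
  exists (phi : formula L) (v : nat -> M), D = [set x | sat (env x v) phi].

Definition elementary L (M N : structure L) (j : M -> N) : Prop :=
  forall (phi : formula L) (v : nat -> M), sat v phi <-> sat (j \o v) phi.

(* A group whose elements are (via [dg_val]) the points of a definable subset
   of a Cartesian power of M, with definable graph of multiplication. *)
Record definable_group L (M : structure L) := DefinableGroup {
  dg_dim : nat;
  dg_sort :> groupType;
  dg_val : dg_sort -> dg_dim.-tuple M;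
  dg_inj : injective dg_val;
  dg_def : definable (range dg_val);
  dg_mul : definable
    [set [tuple of dg_val x ++ dg_val y ++ dg_val (x * y)%g]
      | x in [set: dg_sort] & y in [set: dg_sort]]
}.

Definition ltrans (G : groupType) (g : G) (A : set G) : set G :=
  [set (g * x)%g | x in A].

Record is_galgebra (G : groupType) (A : set_system G) : Prop := IsGAlgebra {
  galg_T : A setT;
  galg_C : forall X, A X -> A (~` X);
  galg_I : setI_closed A;
  galg_L : forall g X, A X -> A (ltrans g X)
}.

Record galgebra (G : groupType) := GAlgebra {
  galg_sets :> set G -> Prop;
  galgP : is_galgebra galg_sets
}.

Record is_ultrafilter (G : groupType) (A p : set_system G) : Prop :=
  IsUltrafilter {
  ultra_sub : p `<=` A;
  ultra_T : p setT;
  ultra_0 : ~ p set0;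
  ultra_I : setI_closed p;
  ultra_up : forall X Y, p X -> A Y -> X `<=` Y -> p Y;
  ultra_or : forall X, A X -> p X \/ p (~` X)
}.

Record stone (G : groupType) (A : galgebra G) := Stone {
  stone_sets :> set G -> Prop;
  stoneP : is_ultrafilter (galg_sets A) stone_sets
}.

(* d_p *)
Definition dmap (G : groupType) (p : set_system G) (A : set G) : set G :=
  [set g | p (ltrans g^-1 A)].

Definition dclosed (G : groupType) (A : set_system G) : Prop :=
  forall p, is_ultrafilter A p -> forall X, A X -> A (dmap p X).

Record ambit (G : groupType) := Ambit {
  amb_space :> topologicalType;
  amb_act : G -> amb_space -> amb_space;
  amb_pt : amb_space;
  amb_act1 : forall x, amb_act 1%g x = x;
  amb_actM : forall g h x, amb_act (g * h)%g x = amb_act g (amb_act h x);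
  amb_cont : forall g, continuous (amb_act g);
  amb_compact : compact [set: amb_space];
  amb_hausdorff : hausdorff_space amb_space;
  amb_zerodim : zero_dimensional amb_space;
  amb_dense : dense [set amb_act g amb_pt | g in [set: G]]
}.

(* A coloring G -> 2^n is given by functions 'I_n -> bool; [true] stands for 1. *)
Definition definable_coloring (G : groupType) (X : ambit G) (S : set X)
    n (c : G -> {ffun 'I_n -> bool}) : Prop :=
  exists (U : 'I_n -> set X) (y : 'I_n -> X),
    [/\ forall i, clopen (U i), forall i, S (y i) &
        forall g i, c g i <-> [set amb_act g x | x in U i] (y i)].

Definition has_DRP (G : groupType) (X : ambit G) (S : set X) : Prop :=
  forall n (c : G -> {ffun 'I_n -> bool}), 0 < n -> definable_coloring S c ->
  forall k (A : set G), 0 < k -> (A #= `I_k)%card ->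
  exists h : G, (c @` ltrans h A #= `I_1)%card.

Definition WDRP (G : groupType) (X : ambit G) : Prop :=
  has_DRP [set amb_pt X].

Definition DRP (G : groupType) (X : ambit G) : Prop :=
  has_DRP [set amb_act g (amb_pt X) | g in [set: G]].

Definition EDRP (G : groupType) (X : ambit G) : Prop :=
  has_DRP [set: X].

Section Translations.
Variable G : groupType.
Implicit Types (g h x : G) (X Y : set G).

Lemma ltransE g X x : ltrans g X x <-> X (g^-1 * x)%g.
Proof.
split=> [[y Xy <-]|Xx]; first by rewrite mulKg.
by exists (g^-1 * x)%g => //; rewrite mulVKg.
Qed.

Lemma ltrans1 X : ltrans 1%g X = X.
Proof. by apply/predeqP => x; rewrite ltransE invg1 mul1g. Qed.

Lemma ltransM g h X : ltrans (g * h)%g X = ltrans g (ltrans h X).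
Proof. by apply/predeqP => x; rewrite !ltransE invgM mulgA. Qed.

Lemma ltransT g : ltrans g setT = setT.
Proof. by apply/predeqP => x; rewrite ltransE. Qed.

Lemma ltrans0 g : ltrans g set0 = set0.
Proof. by apply/predeqP => x; rewrite ltransE. Qed.

Lemma ltransI g X Y : ltrans g (X `&` Y) = ltrans g X `&` ltrans g Y.
Proof. by apply/predeqP => x; rewrite /setI /= !ltransE. Qed.

Lemma ltransC g X : ltrans g (~` X) = ~` ltrans g X.
Proof. by apply/predeqP => x; rewrite /setC /= !ltransE. Qed.

Lemma ltransS g X Y : X `<=` Y -> ltrans g X `<=` ltrans g Y.
Proof. by move=> XY x; rewrite !ltransE; exact: XY. Qed.

Lemma ltransVK g X : ltrans g (ltrans g^-1 X) = X.
Proof. by rewrite -ltransM mulgV ltrans1. Qed.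

End Translations.

HB.instance Definition _ (G : groupType) (A : galgebra G) :=
  gen_eqMixin (stone A).
HB.instance Definition _ (G : groupType) (A : galgebra G) :=
  gen_choiceMixin (stone A).

Section StoneSpace.
Variables (G : groupType) (A : galgebra G).
Implicit Types (p q : stone A) (X Y : set G).

Lemma stone_inj p q : stone_sets p = stone_sets q -> p = q.
Proof.
by case: p => p Hp; case: q => q Hq /= E; subst q; congr Stone; exact: Prop_irrelevance.
Qed.

Definition stone_base X : set (stone A) := [set p : stone A | p X].

Lemma stone_cover : \bigcup_(X in galg_sets A) stone_base X = setT.
Proof.
apply/predeqP => p; split=> // _; exists setT; first exact: galg_T (galgP A).
exact: ultra_T (stoneP p).
Qed.

Lemma stone_join (X Y : set G) (p : stone A) : A X -> A Y ->
  stone_base X p -> stone_base Y p ->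
  exists Z, [/\ A Z, stone_base Z p & stone_base Z `<=` stone_base X `&` stone_base Y].
Proof.
move=> AX AY pX pY; exists (X `&` Y); split.
- exact: galg_I (galgP A) _ _ AX AY.
- exact: ultra_I (stoneP p) _ _ pX pY.
- move=> q qXY; split; apply: (ultra_up (stoneP q) qXY) => //.
Qed.

End StoneSpace.

(* The sets {p : X in p}, for X in A, form a base of the topology. *)
HB.instance Definition _ (G : groupType) (A : galgebra G) :=
  @isBaseTopological.Build (stone A) (set G) (galg_sets A)
    (@stone_base G A) (stone_cover A) (@stone_join G A).

Section StoneAmbit.
Variables (G : groupType) (A : galgebra G).
Implicit Types (p q : stone A) (X Y : set G).

Lemma stone_base_open X : A X -> open (@stone_base G A X).
Proof.
move=> AX; exists [set X]; first by move=> Y /= ->.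
by rewrite bigcup_set1.
Qed.

Lemma stone_openP (O : set (stone A)) p : open O -> O p ->
  exists X, [/\ A X, p X & stone_base X `<=` O].
Proof.
move=> [D DA <-] [X DX pX]; exists X; split=> //; first exact: DA.
by move=> q qX; exists X.
Qed.

Lemma stoneC p X : A X -> p (~` X) <-> ~ p X.
Proof.
move=> AX; split=> [pC pX|npX].
  apply: (ultra_0 (stoneP p)).
  by rewrite -(setICr X); exact: ultra_I (stoneP p) _ _ pX pC.
by have [//|//] := ultra_or (stoneP p) AX.
Qed.

Lemma stone_base_clopen X : A X -> clopen (@stone_base G A X).
Proof.
move=> AX; split; first exact: stone_base_open.
have -> : stone_base X = ~` @stone_base G A (~` X).
  apply/predeqP => p; rewrite /stone_base /setC /= stoneC//.
  by split=> [? //|/contrapT].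
exact: open_closedC (stone_base_open (galg_C (galgP A) AX)).
Qed.

Lemma stone_sep p q : p <> q -> exists X, [/\ A X, p X & ~ q X].
Proof.
move=> pq; apply: contrapT => nX; apply: pq; apply: stone_inj.
have pq X : p X -> q X.
  move=> pX; apply: contrapT => nqX; apply: nX; exists X; split=> //.
  exact: ultra_sub (stoneP p) _ pX.
apply/predeqP => X; split=> [/pq//|qX].
have AX := ultra_sub (stoneP q) qX.
apply: contrapT => /(stoneC _ AX)/pq.
by rewrite stoneC.
Qed.

Lemma stone_act_subproof (g : G) p :
  is_ultrafilter (galg_sets A) [set X | p (ltrans g^-1 X)].
Proof.
have HA := galgP A; have Hp := stoneP p.
split=> /=.
- move=> X /(ultra_sub Hp) /(galg_L HA g); by rewrite ltransVK.
- by rewrite ltransT; exact: ultra_T Hp.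
- by rewrite ltrans0; exact: ultra_0 Hp.
- by move=> X Y pX pY /=; rewrite ltransI; exact: ultra_I Hp _ _ pX pY.
- move=> X Y pX AY XY; apply: (ultra_up Hp pX); first exact: galg_L HA _ _ AY.
  exact: ltransS.
- by move=> X AX; rewrite ltransC; apply: (ultra_or Hp); exact: galg_L HA _ _ AX.
Qed.

(* A lies in g p iff g^-1 A lies in p, i.e. g p = {g A : A in p}. *)
Definition stone_act (g : G) p : stone A := Stone (stone_act_subproof g p).

Lemma stone_pt_subproof : is_ultrafilter (galg_sets A) [set X | A X /\ X 1%g].
Proof.
have HA := galgP A; split=> /=.
- by move=> X [].
- by split=> //; exact: galg_T HA.
- by case.
- by move=> X Y [AX X1] [AY Y1]; split; [exact: galg_I HA _ _ AX AY|].
- by move=> X Y [AX X1] AY XY; split=> //; exact: XY.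
- move=> X AX; have [X1|nX1] := pselect (X 1%g); [by left|right].
  by split=> //; exact: galg_C HA _ AX.
Qed.

Definition stone_pt : stone A := Stone stone_pt_subproof.

Lemma stone_act1 p : stone_act 1%g p = p.
Proof. by apply: stone_inj; apply/predeqP => X /=; rewrite invg1 ltrans1. Qed.

Lemma stone_actM (g h : G) p :
  stone_act (g * h)%g p = stone_act g (stone_act h p).
Proof. by apply: stone_inj; apply/predeqP => X /=; rewrite invgM ltransM. Qed.

Lemma stone_act_cont g : continuous (stone_act g).
Proof.
apply/continuousP => O oO; rewrite openE => p Op.
have [X [AX pX XO]] := stone_openP oO Op.
rewrite /interior nbhsE.
exists (stone_base (ltrans g^-1 X)).
  split=> //; apply: stone_base_open; exact: galg_L (galgP A) _ _ AX.
by move=> q qX; exact: XO.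
Qed.

Lemma stone_compact : compact [set: stone A].
Proof.
rewrite compact_ultra => F UF _.
have FF : ProperFilter F := ultra_proper.
pose p : set_system G := [set X | A X /\ F (@stone_base G A X)].
have HA := galgP A.
have Hp : is_ultrafilter (galg_sets A) p.
  split=> /=.
  - by move=> X [].
  - split; first exact: galg_T HA.
    by apply: filterS filterT => q _; exact: ultra_T (stoneP q).
  - move=> [_ /filter_ex[q]]; exact: ultra_0 (stoneP q).
  - move=> X Y [AX FX] [AY FY]; split; first exact: galg_I HA _ _ AX AY.
    apply: filterS (filterI FX FY) => q [qX qY].
    exact: ultra_I (stoneP q) _ _ qX qY.
  - move=> X Y [AX FX] AY XY; split=> //.
    by apply: filterS FX => q qX; exact: (ultra_up (stoneP q) qX AY XY).
  - move=> X AX; have [FX|FX] := in_ultra_setVsetC (@stone_base G A X) UF.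
      by left.
    right; split; first exact: galg_C HA _ AX.
    by apply: filterS FX => q qX; apply/stoneC.
exists (Stone Hp); split=> // O; rewrite nbhsE => -[O' [oO' O'p] O'O].
have [X [AX [_ FX] XO]] := stone_openP oO' O'p.
by apply: filterS FX => q /XO/O'O.
Qed.

Lemma stone_zerodim : zero_dimensional (stone A).
Proof.
move=> p q /eqP /stone_sep [X [AX pX nqX]]; exists (stone_base X).
by split=> //; exact: stone_base_clopen.
Qed.

Lemma stone_hausdorff : hausdorff_space (stone A).
Proof.
move=> p q pq; apply: contrapT => /stone_sep [X [AX pX /(stoneC _ AX) qX]].
have AC := galg_C (galgP A) AX.
have /(_ _ _)[||r [rX rC]] := pq (stone_base X) (stone_base (~` X)).
- by apply: open_nbhs_nbhs; split=> //; exact: stone_base_open.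
- by apply: open_nbhs_nbhs; split=> //; exact: stone_base_open.
- by move: rC => /(stoneC _ AX); exact.
Qed.

Lemma stone_dense : dense [set stone_act g stone_pt | g in [set: G]].
Proof.
move=> O [p Op] oO; have [X [AX pX XO]] := stone_openP oO Op.
have [g Xg] : X !=set0.
  apply/set0P/eqP => X0; apply: (ultra_0 (stoneP p)); by rewrite -X0.
exists (stone_act g stone_pt); split; last by exists g.
apply: XO; split => /=; first exact: galg_L (galgP A) _ _ AX.
by apply/ltransE; rewrite invgK mulg1.
Qed.

Definition stone_ambit : ambit G :=
  Ambit stone_act1 stone_actM stone_act_cont stone_compact stone_hausdorff
    stone_zerodim stone_dense.

End StoneAmbit.

Section DClosure.
Variables (G : groupType) (A : galgebra G).

(* [smallest C A] is the intersection of the members of C that include A; by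
   [dclosure_galgebra] and [dclosure_dclosed] it is here itself such a member. *)
Definition dclosure_sets : set_system G :=
  smallest [set B : set_system G | is_galgebra B /\ dclosed B] (galg_sets A).

Lemma dclosure_galgebra : is_galgebra dclosure_sets.
Proof.
split.
- by move=> B [[HB _] _]; exact: galg_T HB.
- by move=> X AX B BB; have [[HB _] _] := BB; exact: galg_C HB _ (AX _ BB).
- move=> X Y AX AY B BB; have [[HB _] _] := BB.
  exact: galg_I HB _ _ (AX _ BB) (AY _ BB).
- by move=> g X AX B BB; have [[HB _] _] := BB; exact: galg_L HB _ _ (AX _ BB).
Qed.

Lemma dclosure_dclosed : dclosed dclosure_sets.
Proof.
move=> p Hp X AX B BB; have [[HB dB] AB] := BB.
have pF : ProperFilter (filter_from p id).
  apply: filter_from_proper.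
    apply: filter_from_filter; first by exists setT; exact: ultra_T Hp.
    by move=> Y Z pY pZ; exists (Y `&` Z) => //; exact: ultra_I Hp _ _ pY pZ.
  move=> Y pY; apply/set0P/eqP => Y0; apply: (ultra_0 Hp); by rewrite -Y0.
have [U [UU pU]] := ultraFilterLemma pF.
have UF : ProperFilter U := ultra_proper.
have Hq : is_ultrafilter B (B `&` U).
  split.
  - by move=> Y [].
  - by split; [exact: galg_T HB|exact: filterT].
  - by move=> [_]; exact: filter_not_empty.
  - by move=> Y Z [BY UY] [BZ UZ]; split; [exact: galg_I HB _ _ BY BZ|exact: filterI].
  - by move=> Y Z [BY UY] BZ YZ; split=> //; exact: filterS UY.
  - move=> Y BY; have [UY|UY] := in_ultra_setVsetC Y UU; [by left|right].
    by split=> //; exact: galg_C HB _ BY.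
suff -> : dmap p X = dmap (B `&` U) X by apply: dB => //; exact: AX.
apply/predeqP => g; rewrite /dmap /=.
have AgX := galg_L dclosure_galgebra g^-1 AX.
split=> [pX|[_ UX]].
  by split; [exact: AgX|apply: pU; exists (ltrans g^-1 X)].
have [//|pC] := ultra_or Hp AgX.
have UC : U (~` ltrans g^-1 X) by apply: pU; exists (~` ltrans g^-1 X).
apply: contrapT => _; apply: (@filter_not_empty _ U); rewrite -(setICr (ltrans g^-1 X)).
exact: filterI UX UC.
Qed.

Definition dclosure : galgebra G := GAlgebra dclosure_galgebra.

End DClosure.

Section Env.
Variable T : Type.
Implicit Types (s t : seq T) (v w : nat -> T).

Lemma env_nil v : env [::] v = v.
Proof. by apply/funext => k; rewrite /env /= subn0 nth_nil. Qed.

Lemma env_cons a s v : env (a :: s) v = scons a (env s v).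
Proof. by apply/funext => -[]. Qed.

Lemma env_cat s t v : env (s ++ t) v = env s (env t v).
Proof. by elim: s => [|a s IH]; rewrite /= ?env_nil// !env_cons IH. Qed.

Lemma env_lt s v w k : k < size s -> env s v k = env s w k.
Proof. by move=> ks; apply: set_nth_default. Qed.

Lemma env_add s v k : env s v (size s + k) = v k.
Proof. by rewrite /env addKn nth_default // leq_addr. Qed.

Lemma env_ge s v k : size s <= k -> env s v k = v (k - size s).
Proof. by move=> sk; rewrite -{1}(subnKC sk) env_add. Qed.

End Env.

Section Formulas.
Variable L : language.

Fixpoint tren (r : nat -> nat) (t : term L) : term L :=
  match t with
  | Var i => Var (r i)
  | App f a => App f (fun i => tren r (a i))
  end.

Definition up (r : nat -> nat) : nat -> nat := scons 0 (S \o r).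

Fixpoint fren (r : nat -> nat) (phi : formula L) : formula L :=
  match phi with
  | Fbot => Fbot
  | Feq s t => Feq (tren r s) (tren r t)
  | Frel R a => Frel R (fun i => tren r (a i))
  | Fimp phi psi => Fimp (fren r phi) (fren r psi)
  | Fall phi => Fall (fren (up r) phi)
  end.

Definition Fnot (phi : formula L) := Fimp phi Fbot.
Definition Fand (phi psi : formula L) := Fnot (Fimp phi (Fnot psi)).
Definition Fex (phi : formula L) := Fnot (Fall (Fnot phi)).

Fixpoint Fexn n (phi : formula L) : formula L :=
  if n is m.+1 then Fexn m (Fex phi) else phi.

Variable M : structure L.
Implicit Types (v w : nat -> M) (phi psi : formula L).

Lemma eval_ren r v t : eval v (tren r t) = eval (v \o r) t.
Proof. by elim: t => //= f a IH; congr fint; apply: eq_mktuple. Qed.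

Lemma scons_up a v r : scons a v \o up r = scons a (v \o r).
Proof. by apply/funext => -[]. Qed.

Lemma sat_ren phi : forall r v, sat v (fren r phi) <-> sat (v \o r) phi.
Proof.
elim: phi => [|s t|R a|phi IH1 psi IH2|phi IH] r v //=.
- by rewrite !eval_ren.
- by rewrite (eq_mktuple _ (fun i => eval_ren r v (a i))).
- by rewrite IH1 IH2.
- by split=> H b; have := H b; rewrite IH scons_up.
Qed.

Lemma sat_not v phi : sat v (Fnot phi) <-> ~ sat v phi.
Proof. by []. Qed.

Lemma sat_and v phi psi : sat v (Fand phi psi) <-> sat v phi /\ sat v psi.
Proof.
split=> /= [H|[H1 H2] H]; last exact: H.
by split; apply: contrapT => n; apply: H => ? // => _.
Qed.

Lemma sat_ex v phi : sat v (Fex phi) <-> exists a, sat (scons a v) phi.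
Proof.
split=> /= [H|[a Ha] H]; last exact: (H a).
by apply: contrapT => n; apply: H => a Ha; apply: n; exists a.
Qed.

Lemma sat_exn n : forall v phi,
  sat v (Fexn n phi) <-> exists y : n.-tuple M, sat (env y v) phi.
Proof.
elim: n => [|n IH] v phi /=.
  split=> [H|[y]]; first by exists [tuple]; rewrite env_nil.
  by rewrite tuple0 env_nil.
rewrite IH; split=> [[y /sat_ex[a H]]|[y]].
  by exists [tuple of a :: y]; rewrite env_cons.
case/tupleP: y => a y; rewrite env_cons => H.
by exists y; apply/sat_ex; exists a.
Qed.

Lemma eval_support t : exists K, forall v w,
  (forall k, k < K -> v k = w k) -> eval v t = eval w t.
Proof.
elim: t => [i|f a IH]; first by exists i.+1 => v w /(_ i); apply.
have [K HK] := choice IH.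
exists (\max_i K i) => v w vw /=; congr fint; apply: eq_mktuple => i.
by apply: HK => k kK; apply: vw; exact: leq_trans kK (leq_bigmax i).
Qed.

Lemma sat_support phi : exists K, forall v w,
  (forall k, k < K -> v k = w k) -> sat v phi <-> sat w phi.
Proof.
elim: phi => [|s t|R a|phi [K1 H1] psi [K2 H2]|phi [K HK]].
- by exists 0.
- have [K1 H1] := eval_support s; have [K2 H2] := eval_support t.
  exists (maxn K1 K2) => v w vw /=; rewrite (H1 v w) ?(H2 v w)// => k kK;
    apply: vw; lia.
- have [K HK] := choice (fun i => eval_support (a i)).
  exists (\max_i K i) => v w vw /=.
  rewrite (eq_mktuple _ (fun i => _ : eval v (a i) = eval w (a i)))// => i.
  by apply: HK => k kK; apply: vw; exact: leq_trans kK (leq_bigmax i).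
- exists (maxn K1 K2) => v w vw /=; rewrite (H1 v w) ?(H2 v w)// => k kK;
    apply: vw; lia.
- exists K => v w vw /=.
  have E b : sat (scons b v) phi <-> sat (scons b w) phi.
    by apply: HK => -[|k]//= kK; rewrite vw//; exact: ltnW.
  by split=> H b; have := H b; rewrite E.
Qed.

End Formulas.

Lemma map_env S T (j : S -> T) (s : seq S) (v : nat -> S) :
  env (map j s) (j \o v) = j \o env s v.
Proof.
apply/funext => k; rewrite /env /= size_map.
have [ks|sk] := ltnP k (size s).
  by rewrite (nth_map (v (k - size s))).
by rewrite !nth_default ?size_map.
Qed.

Definition ilv T (a b : nat -> T) (k : nat) : T :=
  if odd k then b k./2 else a k./2.

Lemma ilv_even T (a b : nat -> T) k : ilv a b k.*2 = a k.
Proof. by rewrite /ilv odd_double doubleK. Qed.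

Lemma ilv_odd T (a b : nat -> T) k : ilv a b k.*2.+1 = b k.
Proof. by rewrite /ilv /= odd_double /= uphalf_double. Qed.

Lemma map_ilv S T (j : S -> T) a b : ilv (j \o a) (j \o b) = j \o ilv a b.
Proof. by apply/funext => k; rewrite /ilv /=; case: ifP. Qed.

Section Ultrapower.
Variables (L : language) (M : structure L) (I : Type) (U : set_system I).
Hypothesis UU : UltraFilter U.

Let UF : ProperFilter U := @ultra_proper _ _ UU.

Definition ueq (f g : I -> M) : Prop := U [set i | f i = g i].

Definition ucarrier := {S : set (I -> M) | exists f, S = ueq f}.

Definition ucls (f : I -> M) : ucarrier :=
  exist (fun S : set (I -> M) => exists f, S = ueq f) (ueq f)
    (ex_intro (fun g => ueq f = ueq g) f erefl).

Definition urep (x : ucarrier) : I -> M := projT1 (cid (projT2 x)).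

Lemma ueq_refl f : ueq f f.
Proof. by apply: filterS filterT. Qed.

Lemma uclsP f g : ucls f = ucls g <-> ueq f g.
Proof.
split=> [[->]|fg]; first exact: ueq_refl.
apply: eq_exist; apply/predeqP => h; split=> H.
  by apply: filterS (filterI fg H) => i /= [-> ->].
by apply: filterS (filterI fg H) => i /= [-> ->].
Qed.

Lemma urepK x : ucls (urep x) = x.
Proof.
case: x => S H; apply: eq_exist; rewrite /urep /=.
by case: cid.
Qed.

Definition upower : structure L :=
  @Structure L ucarrier
    (let: inhabits a := carrier_inhabited M in inhabits (ucls (cst a)))
    (fun f x => ucls (fun i => fint (map_tuple (fun y => urep y i) x)))
    (fun r x => U [set i | rint (map_tuple (fun y => urep y i) x)]).

Definition ucl : (I -> M) -> upower := ucls.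
Definition udiag (a : M) : upower := ucl (cst a).

Lemma urep_tuple n (e : 'I_n -> I -> M) :
  U [set i | map_tuple (fun y => urep y i) [tuple ucls (e k) | k < n]
             = [tuple e k i | k < n]].
Proof.
have H : U [set i | forall k, urep (ucls (e k)) i = e k i].
  apply: filter_forall => k; have /uclsP := urepK (ucls (e k)); exact.
apply: filterS H => i Hi; apply: eq_from_tnth => k.
by rewrite tnth_map !tnth_mktuple.
Qed.

Lemma ultra_not (S : set I) : U (~` S) <-> ~ U S.
Proof.
split=> [UC US|nS].
  by apply: (@filter_not_empty _ U); rewrite -(setICr S); exact: filterI.
by have [//|//] := in_ultra_setVsetC S UU.
Qed.

Lemma los_eval (v : nat -> I -> M) t :
  eval (ucl \o v : nat -> upower) t = ucl (fun i => eval (v^~ i) t).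
Proof.
elim: t => [//|f a IH] /=; apply/uclsP; rewrite (eq_mktuple _ IH).
apply: filterS (urep_tuple (fun k i => eval (v^~ i) (a k))) => i /= E.
by congr fint; exact: E.
Qed.

Lemma los phi : forall v : nat -> I -> M,
  sat (ucl \o v : nat -> upower) phi <-> U [set i | sat (v^~ i) phi].
Proof.
elim: phi => [|s t|R a|phi IH1 psi IH2|phi IH] v.
- by split=> // /filter_not_empty.
- by rewrite /= !los_eval; exact: uclsP.
- rewrite /= (eq_mktuple _ (fun k => los_eval v (a k))).
  have E := urep_tuple (fun k i => eval (v^~ i) (a k)).
  split=> H; apply: filterS (filterI E H) => i /= [Ei];
    by rewrite Ei.
- rewrite /= IH1 IH2; split=> H.
    have [H1|H1] := pselect (U [set i | sat (v^~ i) phi]).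
      by apply: filterS (H H1) => i h _; exact: h.
    by move/ultra_not: H1; apply: filterS => i nphi /nphi.
  by move=> H1; apply: filterS (filterI H H1) => i [h1 h2]; exact: h1.
- have sE f : scons (ucl f) (ucl \o v : nat -> upower)
      = (ucl \o scons f v : nat -> upower) by apply/funext => -[].
  have sE' f i : scons (f i) (v^~ i) = (scons f v)^~ i by apply/funext => -[].
  rewrite /=; split=> [H|H x].
    apply: contrapT => /ultra_not nH.
    have /choice[f Hf] : forall i, exists a : M,
        ~ sat (v^~ i) (Fall phi) -> ~ sat (scons a (v^~ i)) phi.
      move=> i; have [h|h] := pselect (sat (v^~ i) (Fall phi)).
        by have [a] := carrier_inhabited M; exists a.
      by move/existsNP: h => [a ha]; exists a.
    have := H (ucl f); rewrite sE => /IH Uf.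
    apply: (@filter_not_empty _ U); apply: filterS (filterI Uf nH) => i /= [h1 h2].
    by apply: (Hf i h2); rewrite sE'.
  rewrite -(urepK x) -/(ucl _) sE; apply/IH.
  by apply: filterS H => i /= /(_ (urep x i)); rewrite sE'.
Qed.

Lemma udiag_elementary : elementary udiag.
Proof.
move=> phi v; rewrite -[udiag \o v]/(ucl \o (fun k => cst (v k))) los.
split=> [H|/filter_ex[i]//]; first by apply: filterS filterT.
Qed.

End Ultrapower.

Section Definable.
Variables (L : language) (M : structure L) (n : nat).
Implicit Types D E : set (n.-tuple M).

Lemma definableT : definable (setT : set (n.-tuple M)).
Proof.
have [a] := carrier_inhabited M.
by exists (Fnot Fbot), (fun=> a); apply/predeqP => x; split=> // _ /=.
Qed.

Lemma definableC D : definable D -> definable (~` D).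
Proof. by move=> [phi [v ->]]; exists (Fnot phi), v. Qed.

(* keeps the variables below n and spreads the others *)
Definition shift_par (s : nat -> nat) (k : nat) : nat :=
  if k < n then k else n + s (k - n).

Lemma env_shift_par T (x : n.-tuple T) (u v : nat -> T) s :
  u \o s = v -> env x u \o shift_par s = env x v.
Proof.
move=> <-; apply/funext => k; rewrite /= /shift_par.
have [kn|nk] := ltnP k n; first by apply: set_nth_default; rewrite size_tuple.
rewrite /env size_tuple addKn !nth_default ?size_tuple//; exact: leq_addr.
Qed.

Lemma definableI D E : definable D -> definable E -> definable (D `&` E).
Proof.
move=> [phi [v ->]] [psi [w ->]].
exists (Fand (fren (shift_par double) phi) (fren (shift_par (S \o double)) psi)).
exists (ilv v w); apply/predeqP => x.
apply: iff_sym; apply: (iff_trans (sat_and _ _ _)); rewrite !sat_ren.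
rewrite (@env_shift_par _ _ _ v) ?(@env_shift_par _ _ _ w)//.
  by apply/funext => k /=; rewrite ilv_odd.
by apply/funext => k /=; rewrite ilv_even.
Qed.

End Definable.

Lemma cat_inj T (s1 s2 t1 t2 : seq T) : size s1 = size t1 ->
  s1 ++ s2 = t1 ++ t2 -> s1 = t1 /\ s2 = t2.
Proof.
move=> E H; split.
  by have := congr1 (take (size s1)) H; rewrite take_size_cat// E take_size_cat.
by have := congr1 (drop (size s1)) H; rewrite drop_size_cat// E drop_size_cat.
Qed.

Lemma envt_lt T n (t : n.-tuple T) (v w : nat -> T) k :
  k < n -> env t v k = env t w k.
Proof. by move=> kn; apply: env_lt; rewrite size_tuple. Qed.

Lemma envt_ge T n (t : n.-tuple T) (v : nat -> T) k :
  n <= k -> env t v k = v (k - n).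
Proof. by move=> nk; rewrite env_ge ?size_tuple. Qed.

Lemma envt_nth T n (t : n.-tuple T) (v : nat -> T) (k : 'I_n) :
  env t v k = tnth t k.
Proof.
by rewrite (tnth_nth (tnth t k)); apply: set_nth_default; rewrite size_tuple.
Qed.

Section GroupAlgebras.
Variables (L : language) (M : structure L) (G : definable_group M).
Let n := dg_dim G.

Definition Def_sets : set_system G :=
  [set A | definable [set dg_val g | g in A]].

Definition trace (N : structure L) (j : M -> N) (D : set (n.-tuple N)) : set G :=
  [set g | D (map_tuple j (dg_val g))].

Definition Ext_sets : set_system G :=
  [set A | exists (N : structure L) (j : M -> N) (D : set (n.-tuple N)),
    [/\ elementary j, definable D & A = trace j D]].

Lemma elementary_inj (N : structure L) (j : M -> N) : elementary j -> injective j.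
Proof.
move=> ej a b jab.
have := ej (Feq (Var 0) (Var 1)) (scons a (fun=> b)).
by case=> /= _; apply.
Qed.

Lemma trace_ltrans (N : structure L) (j : M -> N) (D : set (n.-tuple N)) (g : G) :
  elementary j -> definable D ->
  exists2 E, definable E & ltrans g (trace j D) = trace j E.
Proof.
move=> ej [phi [b ->]].
have [mu [w muE]] := dg_mul G.
have vI (x y : G) : dg_val x = dg_val y :> seq M -> x = y.
  by move=> E; apply: (@dg_inj _ _ G); exact: val_inj.
have muP (x y z : G) : sat (env (dg_val x) (env (dg_val y) (env (dg_val z) w))) mu
    <-> z = (x * y)%g.
  have := congr1 (fun S => S [tuple of dg_val x ++ dg_val y ++ dg_val z]) muE.
  rewrite /= !env_cat => <-; split=> [[x' _ [y' _]]|->]; last by exists x => //; exists y.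
  move=> /(congr1 (@tval _ _)) /= /cat_inj.
  rewrite !size_tuple => -[]// /vI -> /cat_inj.
  by rewrite !size_tuple => -[]// /vI -> /vI ->.
(* in N, the only y such that j g * y = j h is j (g^-1 h) *)
have muN (h : G) (y : n.-tuple N) :
    sat (env (map j (dg_val g)) (env y (env (map j (dg_val h)) (j \o w)))) mu
    <-> y = map_tuple j (dg_val (g^-1 * h)%g).
  split=> [Hy|->]; last first.
    by rewrite /= !map_env; apply/ej/muP; rewrite mulVKg.
  apply: eq_from_tnth => k; apply: contrapT => ny.
  pose c := dg_val (g^-1 * h)%g.
  pose V := env (dg_val g) (env (dg_val h) (env c w)).
  pose r i := if i < n then n + i else if i < n + n then i - n
    else if i < n + n + n then i else n + i.
  pose psi := Fexn n (Fand (fren r mu) (Fnot (Feq (Var k) (Var (n + n + n + k))))).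
  have rE T (t1 t2 t3 t4 : n.-tuple T) (u : nat -> T) :
      env t2 (env t1 (env t3 (env t4 u))) \o r = env t1 (env t2 (env t3 u)).
    apply/funext => i; rewrite /r /=.
    have [i1|i1] := ltnP i n.
      rewrite envt_ge; last lia.
      by rewrite addKn; exact: envt_lt.
    rewrite [RHS]envt_ge//.
    have [i2|i2] := ltnP i (n + n); first by apply: envt_lt; lia.
    rewrite [RHS]envt_ge; last lia.
    have [i3|i3] := ltnP i (n + n + n).
      do 2 (rewrite envt_ge; last lia).
      by apply: envt_lt; lia.
    do 4 (rewrite envt_ge; last lia).
    rewrite [RHS]envt_ge; last lia.
    congr u; lia.
  have cE T (t1 t2 t3 t4 : n.-tuple T) (u : nat -> T) :
      env t2 (env t1 (env t3 (env t4 u))) (n + n + n + k) = tnth t4 k.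
    do 3 (rewrite envt_ge; last lia).
    rewrite (_ : n + n + n + k - n - n - n = k); last lia.
    exact: envt_nth.
  have yE T (t2 : n.-tuple T) (u : nat -> T) : env t2 u k = tnth t2 k.
    exact: envt_nth.
  have : sat (j \o V) psi.
    apply/sat_exn; exists y; apply/sat_and.
    rewrite sat_ren /V -!map_env.
    rewrite (rE _ (map_tuple j _) y (map_tuple j _) (map_tuple j _)).
    split; first exact: Hy.
    rewrite sat_not /= yE.
    by rewrite (cE _ (map_tuple j _) y (map_tuple j _) (map_tuple j _)).
  move/ej/sat_exn => [z /sat_and[]]; rewrite sat_ren /V rE sat_not /= yE cE => Hz.
  apply; congr tnth.
  have /predeqP/(_ [tuple of dg_val g ++ z ++ dg_val h]) := muE.
  rewrite /= !env_cat => -[_ /(_ Hz)] [x' _ [y' _]].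
  move=> /(congr1 (@tval _ _)) /= /cat_inj.
  rewrite !size_tuple => -[]// /vI xg /cat_inj.
  rewrite !size_tuple => -[]// zE /vI yh.
  by apply: val_inj; rewrite /= /c -yh -xg mulKg zE.
pose p := env (map j (dg_val g)) (j \o w).
pose rm i := if i < n then n + n + i.*2 else if i < n + n then i - n
  else if i < n + n + n then i - n else n + n + (i - n - n).*2.
pose rp i := if i < n then i else n + n + (i - n).*2.+1.
exists [set x | sat (env x (ilv p b)) (Fexn n (Fand (fren rm mu) (fren rp phi)))].
  by eexists; exists (ilv p b).
apply/predeqP => h; apply: (iff_trans (ltransE _ _ _)).
set q := map_tuple j (dg_val h).
apply: (iff_trans _ (iff_sym (sat_exn _ _ _))).
have rmE (y : n.-tuple N) : env y (env q (ilv p b)) \o rm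
    = env (map j (dg_val g)) (env y (env q (j \o w))).
  apply/funext => i; rewrite /rm /=.
  have [i1|i1] := ltnP i n.
    do 2 (rewrite envt_ge; last lia).
    rewrite (_ : n + n + i.*2 - n - n = i.*2); last lia.
    by rewrite ilv_even; apply: (@envt_lt _ _ (map_tuple j (dg_val g))).
  rewrite [RHS](@envt_ge _ _ (map_tuple j (dg_val g)))//.
  have [i2|i2] := ltnP i (n + n); first by apply: envt_lt; lia.
  rewrite [RHS]envt_ge; last lia.
  have [i3|i3] := ltnP i (n + n + n).
    rewrite envt_ge; last lia.
    by apply: envt_lt; lia.
  do 2 (rewrite envt_ge; last lia).
  rewrite (_ : n + n + (i - n - n).*2 - n - n = (i - n - n).*2); last lia.
  rewrite ilv_even /p (@envt_ge _ _ (map_tuple j (dg_val g))); last by rewrite -/n; lia.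
  by rewrite envt_ge; last lia.
have rpE (y : n.-tuple N) : env y (env q (ilv p b)) \o rp = env y b.
  apply/funext => i; rewrite /rp /=.
  have [i1|i1] := ltnP i n; first exact: envt_lt.
  do 3 (rewrite envt_ge; last lia).
  rewrite (_ : n + n + (i - n).*2.+1 - n - n = (i - n).*2.+1); last lia.
  by rewrite ilv_odd.
split=> [H|[y]].
  exists (map_tuple j (dg_val (g^-1 * h)%g)).
  by rewrite sat_and !sat_ren rmE rpE; split=> //; apply/muN.
by rewrite sat_and !sat_ren rmE rpE => -[/muN -> ].
Qed.

Lemma Def_setsP (A : set G) :
  Def_sets A <-> exists2 D : set (n.-tuple M), definable D & A = trace id D.
Proof.
have mE (t : n.-tuple M) : map_tuple id t = t by apply: val_inj; rewrite /= map_id.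
split=> [dA|[D dD ->]].
  exists [set dg_val g | g in A] => //; apply/predeqP => g; rewrite /trace /= mE.
  by split=> [Ag|[h Ah /(@dg_inj _ _ G) <-]//]; exists g.
rewrite /Def_sets /=.
suff -> : [set dg_val g | g in trace id D] = range (@dg_val _ _ G) `&` D.
  exact: definableI (dg_def G) dD.
apply/predeqP => x; split=> [[g]|[[g _ <-] Dg]].
  by rewrite /trace /= mE => Dg <-; split=> //; exists g.
by exists g => //; rewrite /trace /= mE.
Qed.

Lemma id_elementary : elementary (id : M -> M).
Proof. by []. Qed.

Lemma Def_galgebra : is_galgebra Def_sets.
Proof.
split.
- by apply/Def_setsP; exists setT => //; exact: definableT.
- move=> X /Def_setsP[D dD ->]; apply/Def_setsP; exists (~` D) => //.
  exact: definableC.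
- move=> X Y /Def_setsP[D dD ->] /Def_setsP[E dE ->].
  by apply/Def_setsP; exists (D `&` E) => //; exact: definableI.
- move=> g X /Def_setsP[D dD ->]; apply/Def_setsP.
  exact: trace_ltrans id_elementary dD.
Qed.

(* The type of an infinite tuple of N over M generates a filter on tuples of M. *)
Section TypeFilter.
Variables (N : structure L) (j : M -> N) (b : nat -> N).
Hypothesis ej : elementary j.

Definition tpF : set_system (nat -> M) :=
  [set X | exists (theta : formula L) (w : nat -> M),
    sat (ilv (j \o w) b) theta /\ forall v, sat (ilv w v) theta -> X v].

Lemma sat_reflect K : forall (theta : formula L) (a : nat -> N) (w : nat -> M),
  sat (env (mkseq a K) (j \o w)) theta ->
  exists a' : nat -> M, sat (env (mkseq a' K) w) theta.
Proof.
elim: K => [|K IH] theta a w H.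
  have [m] := carrier_inhabited M.
  by exists (fun=> m); move: H; rewrite /mkseq /= !env_nil => /ej.
have mk T (c : nat -> T) : mkseq c K.+1 = c 0 :: mkseq (c \o S) K.
  rewrite /mkseq /=; congr cons; rewrite -[1%N]addn0 iotaDl -map_comp.
  exact: eq_map.
move: H; rewrite mk env_cons => H.
have [|a' /sat_ex[m Hm]] := IH (Fex theta) (a \o S) w.
  by apply/sat_ex; exists (a 0).
by exists (scons m a'); rewrite mk env_cons.
Qed.

Lemma tpF_proper : ProperFilter tpF.
Proof.
apply: Build_ProperFilter_ex.
  move=> X [theta [w [H HX]]].
  have [K HK] := sat_support M theta.
  have [K' HK'] := sat_support N theta.
  pose m := maxn K K'.
  pose r k := if odd k then (if k./2 < m then k./2 else 0) else m + k./2.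
  have rE T (c u : nat -> T) k : k < m ->
      (env (mkseq c m) u \o r) k = ilv u c k.
    move=> km; rewrite /r /ilv /=; case: ifP => ko.
      have k2 : k./2 < m by lia.
      by rewrite k2 /env nth_mkseq.
    by rewrite env_ge size_mkseq ?leq_addr// addKn.
  have : sat (env (mkseq b m) (j \o w)) (fren r theta).
    apply/sat_ren; apply/(HK' _ (ilv (j \o w) b)) => // k kK.
    by rewrite rE //; lia.
  case/sat_reflect => a' /sat_ren Ha; exists a'; apply: HX.
  by apply/(HK (env (mkseq a' m) w \o r)) => // k kK; rewrite rE //; lia.
split.
- have [m] := carrier_inhabited M.
  by exists (Fnot Fbot), (fun=> m); split=> //= [].
- move=> X Y [th1 [w1 [H1 X1]]] [th2 [w2 [H2 Y2]]].
  pose s (f : nat -> nat) k := if odd k then k else (f k./2).*2.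
  have sE T (a c d : nat -> T) f : a \o f = d -> ilv a c \o s f = ilv d c.
    move=> <-; apply/funext => k; rewrite /s /=; case: ifP => ko.
      by rewrite /ilv ko.
    by rewrite ilv_even /ilv ko.
  have e1 T (a c : nat -> T) : ilv a c \o double = a.
    by apply/funext => k; rewrite /= ilv_even.
  have e2 T (a c : nat -> T) : ilv a c \o (S \o double) = c.
    by apply/funext => k; rewrite /= ilv_odd.
  exists (Fand (fren (s double) th1) (fren (s (S \o double)) th2)), (ilv w1 w2).
  rewrite -map_ilv; split.
    by rewrite sat_and !sat_ren (sE _ _ _ _ _ (e1 _ _ _)) (sE _ _ _ _ _ (e2 _ _ _)).
  move=> v; rewrite sat_and !sat_ren (sE _ _ _ _ _ (e1 _ _ _)).
  by rewrite (sE _ _ _ _ _ (e2 _ _ _)) => -[/X1 ? /Y2].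
- move=> X Y XY [theta [w [H HX]]]; exists theta, w; split=> // v /HX; exact: XY.
Qed.

Lemma tpF_sat (x : n.-tuple M) phi :
  sat (env (map j x) b) phi -> tpF [set v | sat (env x v) phi].
Proof.
move=> H; have [m] := carrier_inhabited M.
pose r k := if k < n then k.*2 else (k - n).*2.+1.
have rE T (t : n.-tuple T) (d c : nat -> T) : ilv (env t d) c \o r = env t c.
  apply/funext => k; rewrite /r /=.
  have [kn|nk] := ltnP k n.
    by rewrite ilv_even; apply: set_nth_default; rewrite size_tuple.
  by rewrite ilv_odd env_ge ?size_tuple.
exists (fren r phi), (env x (fun=> m)).
split=> [|v]; last by rewrite sat_ren rE.
by rewrite -map_env sat_ren (rE _ (map_tuple j x)).
Qed.

End TypeFilter.

(* Two elementary extensions can be replaced by a single one. *)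
Lemma Ext_sets2 (A B : set G) : Ext_sets A -> Ext_sets B ->
  exists (N : structure L) (j : M -> N) (D E : set (n.-tuple N)),
    [/\ elementary j, definable D, definable E, A = trace j D & B = trace j E].
Proof.
move=> [N1 [j1 [_ [e1 [phi1 [b1 ->]] ->]]]] [N2 [j2 [_ [e2 [phi2 [b2 ->]] ->]]]].
have F1 := tpF_proper b1 e1; have F2 := tpF_proper b2 e2.
have [U [UU FU]] := ultraFilterLemma
  (filter_prod_proper : ProperFilter (filter_prod (tpF j1 b1) (tpF j2 b2))).
have UF : ProperFilter U by exact: ultra_proper.
have U1 X : tpF j1 b1 X -> U [set i | X i.1].
  by move=> FX; apply: FU; exists (X, setT) => [|i []//]; split=> //; exact: filterT.
have U2 X : tpF j2 b2 X -> U [set i | X i.2].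
  by move=> FX; apply: FU; exists (setT, X) => [|i []//]; split=> //; exact: filterT.
pose cc k (i : (nat -> M) * (nat -> M)) := ilv i.1 i.2 k.
pose c : nat -> upower M U := ucl (M := M) U \o cc.
have key (g : G) (s : nat -> nat) (phi : formula L) :
    sat (env (map (udiag (M := M) U) (dg_val g)) c) (fren (shift_par n s) phi)
    <-> U [set i | sat (env (dg_val g) (ilv i.1 i.2 \o s)) phi].
  have -> : env (map (udiag (M := M) U) (dg_val g)) c
      = ucl (M := M) U \o (fun k i => env (dg_val g) (ilv i.1 i.2) k).
    apply/funext => k; rewrite /= {1}/env size_map.
    have [kn|nk] := ltnP k (size (dg_val g)).
      have [m] := carrier_inhabited M.
      rewrite (nth_map m)//; congr ucl; apply/funext => i.
      by rewrite /cst; apply: set_nth_default.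
    rewrite nth_default ?size_map//; congr ucl; apply/funext => i.
    by rewrite env_ge.
  rewrite los.
  by split; apply: filterS => i /=; rewrite sat_ren (env_shift_par _ erefl).
have ie (i : (nat -> M) * (nat -> M)) : ilv i.1 i.2 \o double = i.1.
  by apply/funext => k /=; rewrite ilv_even.
have io (i : (nat -> M) * (nat -> M)) : ilv i.1 i.2 \o (S \o double) = i.2.
  by apply/funext => k /=; rewrite ilv_odd.
exists (upower M U), (udiag (M := M) U).
exists [set x | sat (env x c) (fren (shift_par n double) phi1)].
exists [set x | sat (env x c) (fren (shift_par n (S \o double)) phi2)].
split.
- exact: udiag_elementary.
- by eexists; exists c.
- by eexists; exists c.
- apply/predeqP => g; rewrite /trace /= key; split=> [H|H].
    have /U1 := tpF_sat H.
    by apply: filterS => i /=; rewrite ie.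
  apply: contrapT => nH; have /U1 UC := tpF_sat (phi := Fnot phi1) nH.
  apply: (@filter_not_empty _ U); apply: filterS (filterI H UC) => i /=.
  by rewrite ie => -[? ]; apply.
- apply/predeqP => g; rewrite /trace /= key; split=> [H|H].
    have /U2 := tpF_sat H.
    by apply: filterS => i /=; rewrite io.
  apply: contrapT => nH; have /U2 UC := tpF_sat (phi := Fnot phi2) nH.
  apply: (@filter_not_empty _ U); apply: filterS (filterI H UC) => i /=.
  by rewrite io => -[? ]; apply.
Qed.

Lemma Ext_galgebra : is_galgebra Ext_sets.
Proof.
split.
- exists M, id, setT; split=> //; exact: definableT.
- move=> X [N [j [D [ej dD ->]]]]; exists N, j, (~` D); split=> //.
  exact: definableC.
- move=> X Y AX /(Ext_sets2 AX) [N [j [D [E [ej dD dE -> ->]]]]].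
  by exists N, j, (D `&` E); split=> //; exact: definableI.
- move=> g X [N [j [D [ej dD ->]]]]; have [E dE ->] := trace_ltrans g ej dD.
  by exists N, j, E.
Qed.

(* S_G(M) and S_{G,ext}(M), with tp(e/M) and tp_ext(e/M), are the Stone spaces
   of these two algebras, with the ultrafilter of the sets containing 1. *)
Definition Def_alg : galgebra G := GAlgebra Def_galgebra.
Definition Ext_alg : galgebra G := GAlgebra Ext_galgebra.

End GroupAlgebras.

(* Main.v *)
Require Import Defs.
From mathcomp Require Import all_boot.
From mathcomp Require Import boolp classical_sets cardinality filter.
From mathcomp Require Import topology zify.

(** Since the clopen subsets of S(A) are the sets [X] = {p : X in p} with X in
    A, and p lies in g[X] iff g^-1 lies in d_p(X), a coloring of the ambit
    S(A) that is definable over a set P of ultrafilters is nothing but a finite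
    list of sets d_p(X)^-1 with p in P and X in A.  So S-DRP of the ambit
    depends only on a family of subsets of G: it says that every finite subset
    of G has a translate on which finitely many members of the family
    ([dsets A P]) are simultaneously constant ([DRP_dsetsP]).  This property
    passes from a family to the Boolean algebra that it generates
    ([homogeneous_boolgen]).

    For P = {p_e} the family is A itself, as d_{p_e}(X) = X.  For the orbit of
    p_e it consists of the right translates of the members of A, and for
    P = S(A) of all d_p(X).  Each of the claims is thus a comparison of
    families.

    - If A is d-closed, then d_p(X) is in A, the three families coincide and so
      do the three properties ([dclosed_DRP]).  This applies to the d-closure by
      construction.  It applies to externally definable sets ([Ext_dclosed])
      because an ultrafilter U on G containing p provides in the ultrapower N^U
      a point, the class of the identity x |-> x, which realizes p: by Los'
      theorem, g^-1 X is in p iff the product of g with this point lies in the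
      set that defines X, a condition on g that is definable in N^U.

    - A right translate of a definable set is definable
      ([Def_rtrans]), so the family of the orbit is Def(G) again.

    - The Boolean algebra generated by the sets d_p(X) is the d-closure of A
      ([dclosure_boolgen]): it contains X = d_{p_e}(X), it is invariant under
      translations as g d_p(X) = d_p(gX), and d_q(d_p(X)) = d_r(X) where r
      consists of the Y with d_p(Y) in q.  So EDRP of S(A) and EDRP of S(A^d)
      speak about a family and the Boolean algebra that it generates. *)

Set Implicit Arguments.
Unset Strict Implicit.
Unset Printing Implicit Defensive.

Local Open Scope nat_scope.
Local Open Scope classical_set_scope.

(** * Homogeneous families of subsets of a group *)

Section Homogeneous.
Variable G : groupType.
Implicit Types (F : set_system G) (X Y : set G) (g h x y : G).

(** Inverses occur because colors are read off from g^-1: the point p lies in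
    gU iff g^-1 p lies in U. *)
Definition homogeneous F : Prop :=
  forall (F0 : set (set G)) (B : set G),
    finite_set F0 -> F0 `<=` F -> finite_set B ->
  exists h, forall Y, F0 Y -> forall x y, B x -> B y ->
    Y (h * x)^-1%g -> Y (h * y)^-1%g.

Lemma homogeneousS F F' : F `<=` F' -> homogeneous F' -> homogeneous F.
Proof. by move=> FF' H F0 B fF0 F0F; apply: H => // Y /F0F /FF'. Qed.

Inductive boolgen F : set_system G :=
| boolgen_in Y of F Y : boolgen F Y
| boolgenT : boolgen F setT
| boolgenC Y of boolgen F Y : boolgen F (~` Y)
| boolgenI X Y of boolgen F X & boolgen F Y : boolgen F (X `&` Y).

Lemma boolgen_support F Y : boolgen F Y ->
  exists F0 : set (set G), [/\ finite_set F0, F0 `<=` F &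
    forall x y, (forall Z, F0 Z -> Z x <-> Z y) -> Y x <-> Y y].
Proof.
elim=> {Y} [Y FY||Y _ [F0 [fF0 F0F H]]|X Y _ [F1 [fF1 F1F H1]] _ [F2 [fF2 F2F H2]]].
- exists [set Y]; split; first exact: finite_set1.
    by move=> _ ->.
  by move=> x y; apply.
- by exists set0; split.
- exists F0; split=> // x y /H E; split=> nY Yz; apply: nY; exact/E.
- exists (F1 `|` F2); split; first by rewrite finite_setU.
    by move=> Z [/F1F|/F2F].
  move=> x y E.
  have E1 : X x <-> X y by apply: H1 => Z FZ; apply: E; left.
  have E2 : Y x <-> Y y by apply: H2 => Z FZ; apply: E; right.
  by split=> -[/E1 ? /E2 ?].
Qed.

(** A member of the generated algebra is constant wherever the finitely many
    members of F on which it depends are. *)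
Lemma homogeneous_boolgen F : homogeneous F -> homogeneous (boolgen F).
Proof.
move=> H F0 B fF0 F0F fB.
have /choice[S HS] : forall Y, exists S : set (set G), F0 Y ->
    [/\ finite_set S, S `<=` F &
      forall x y, (forall Z, S Z -> Z x <-> Z y) -> Y x <-> Y y].
  move=> Y; have [/F0F/boolgen_support[S HS]|nF] := pselect (F0 Y).
    by exists S.
  by exists set0.
have [||h Hh] := H (\bigcup_(Y in F0) S Y) B _ _ fB.
- by apply: bigcup_finite => // Y /HS[].
- by move=> Z [Y /HS[_ + _]]; exact.
exists h => Y FY x y Bx By; have [_ _ E] := HS _ FY.
by apply: (E _ _ _).1 => Z SZ; split; apply: Hh => //; exists Y.
Qed.

End Homogeneous.

(** * Finite sets *)

Lemma card1_image (S T : Type) (B : set S) (c : S -> T) : B !=set0 ->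
  (c @` B #= `I_1)%card <-> forall x y, B x -> B y -> c x = c y.
Proof.
move=> [b Bb]; split=> [/eq_cardSP[t _]|H].
  rewrite II0 card_eq0 => /eqP Bt x y Bx By.
  have E z : B z -> c z = t.
    move=> Bz; apply: contrapT => nt.
    suff : (c @` B `\ t) (c z) by rewrite Bt.
    by split=> //; exists z.
  by rewrite !E.
suff -> : c @` B = [set c b] by exact: card_set1.
by apply/predeqP => t; split=> [[x Bx <-]|->]; [exact: H|exists b].
Qed.

Lemma finite_nonempty_card T (B : set T) : finite_set B -> B !=set0 ->
  exists k, (B #= `I_k.+1)%card.
Proof.
move=> /finite_setP[[|k] Bk] [b Bb]; last by exists k.
by move: Bk; rewrite II0 card_eq0 => /eqP B0; move: Bb; rewrite B0.
Qed.

Lemma finite_nonempty_range (T : eqType) (F : set T) : finite_set F -> F !=set0 ->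
  exists n (Y : 'I_n.+1 -> T), F = range Y.
Proof.
move=> /finite_seqP[[|z s] ->] [x Fx]; first by [].
exists (size s), (fun i => nth z (z :: s) i).
apply/predeqP => y; split=> [/= ys|[i _ <-]].
  have ys' : index y (z :: s) < size (z :: s) by rewrite index_mem.
  by exists (Ordinal ys') => //=; rewrite nth_index.
by rewrite /= mem_nth.
Qed.

(** * Definable colorings of a Stone space *)

Section Stone.
Variables (G : groupType) (A : galgebra G).
Implicit Types (p q : stone A) (P : set (stone A)) (X Y Z : set G).

Lemma galgU X Y : A X -> A Y -> A (X `|` Y).
Proof.
move=> AX AY; rewrite -(setCK (X `|` Y)) setCU; have HA := galgP A.
by apply: galg_C => //; apply: galg_I => //; exact: galg_C.
Qed.

Lemma galg0 : A set0.
Proof. by rewrite -setCT; apply: galg_C (galgP A) _ _; exact: galg_T (galgP A). Qed.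

(** By compactness: if no basic clopen subset exhausts U, then the sets U minus
    [Z] generate a proper filter on U, and a cluster point of it in the closed
    set U has no basic neighbourhood inside the open set U. *)
Lemma clopen_stone_base (U : set (stone A)) : clopen U ->
  exists2 X, A X & U = stone_base X.
Proof.
move=> [oU cU]; apply: contrapT => nU.
pose D := [set Z | A Z /\ stone_base Z `<=` U].
pose F := filter_from D (fun Z => U `\` @stone_base G A Z).
have FF : ProperFilter F.
  apply: filter_from_proper.
    apply: filter_from_filter.
      by exists set0; split=> [|p /(ultra_0 (stoneP p))//]; exact: galg0.
    move=> Y Z [AY YU] [AZ ZU]; exists (Y `|` Z).
      split; first exact: galgU.
      move=> p pYZ; have [pY|pY] := ultra_or (stoneP p) AY; first exact: YU.
      apply: ZU; apply: (ultra_up (stoneP p) (ultra_I (stoneP p) pYZ pY)) => //.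
      by move=> x [[|//] ? nYx].
    move=> p [Up npYZ]; split; split=> // pS; apply: npYZ;
      apply: (ultra_up (stoneP p) pS); try exact: galgU.
    - exact: subsetUl.
    - exact: subsetUr.
  move=> Z [AZ ZU]; apply: contrapT => nE; apply: nU; exists Z => //.
  apply/predeqP => p; split=> [Up|/ZU//].
  by apply: contrapT => npZ; apply: nE; exists p.
have FU : F U.
  exists set0; last by move=> p [].
  by split=> [|p /(ultra_0 (stoneP p))//]; exact: galg0.
have [p [Up clp]] := subclosed_compact cU (stone_compact (A := A)) (fun=> fun=> I)
  FF FU.
have [X [AX pX XU]] := stone_openP oU Up.
have /(_ _ _)[||q [[_ nqX] qX]] := clp (U `\` stone_base X) (stone_base X).
- by exists X.
- by apply: open_nbhs_nbhs; split=> //; exact: stone_base_open.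
- exact: nqX.
Qed.

Lemma stone_act_base g p X :
  A X -> [set @amb_act _ (stone_ambit A) g x | x in @stone_base G A X] p
    <-> dmap p X g^-1%g.
Proof.
move=> AX; rewrite /dmap /= invgK; split=> [[q qX <-]|pX].
  by rewrite /= -ltransM mulVg ltrans1.
exists (stone_act g^-1%g p); first by rewrite /stone_base /= invgK.
by rewrite /= -stone_actM mulgV stone_act1.
Qed.

Lemma ltrans_nonempty g X : X !=set0 -> ltrans g X !=set0.
Proof. by move=> [x Xx]; exists (g * x)%g; exists x. Qed.

(** The inverses of these sets are the possible coordinates of the colorings
    that are definable over P. *)
Definition dsets P : set_system G := [set dmap p X | p in P & X in galg_sets A].

Lemma dsetsS P P' : P `<=` P' -> dsets P `<=` dsets P'.
Proof. by move=> PP' _ [p /PP' Pp [X AX <-]]; exists p => //; exists X. Qed.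

Theorem DRP_dsetsP P :
  @has_DRP G (stone_ambit A) P <-> homogeneous (dsets P).
Proof.
split=> [H F0 B fF0 F0P fB|H n c n0 [U [y [cU Py cE]]] k B k0 Bk].
  have [->|/set0P B0] := eqVneq B set0; first by exists 1%g.
  have [->|/set0P F00] := eqVneq F0 set0; first by exists 1%g.
  have [k Bk] := finite_nonempty_card fB B0.
  have [n [Y F0E]] := finite_nonempty_range fF0 F00.
  have /choice[d Hd] : forall i : 'I_n.+1, exists d : stone A * set G,
      [/\ P d.1, A d.2 & Y i = dmap d.1 d.2].
    move=> i; have [|p Pp [X AX E]] := F0P (Y i); first by rewrite F0E; exists i.
    by exists (p, X).
  pose c (g : G) : {ffun 'I_n.+1 -> bool} := [ffun i => `[< Y i g^-1%g >]].
  have [|h /(card1_image _ (ltrans_nonempty _ B0)) Hh] := H n.+1 c isT _ k.+1 B isT Bk.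
    exists (fun i => stone_base (d i).2), (fun i => (d i).1); split.
    - by move=> i; have [_ AX _] := Hd i; exact: stone_base_clopen.
    - by move=> i; have [] := Hd i.
    - move=> g i; have [_ AX E] := Hd i.
      apply: (iff_trans _ (iff_sym (stone_act_base _ _ AX))).
      by rewrite ffunE -E; split=> /asboolP.
  exists h; rewrite F0E => _ [i _ <-] x z Bx Bz.
  have := Hh _ _ (ex_intro2 _ _ x Bx erefl) (ex_intro2 _ _ z Bz erefl).
  move=> /(congr1 (fun f : {ffun _} => f i)); rewrite !ffunE => E /asboolP.
  by rewrite E => /asboolP.
have /choice[X HX] : forall i, exists X, A X /\ U i = stone_base X.
  by move=> i; have [X AX E] := clopen_stone_base (cU i); exists X.
have fB : finite_set B by apply/finite_setP; exists k.
have [||h Hh] := H (range (fun i => dmap (y i) (X i))) B _ _ fB.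
- exact: finite_image finite_finset.
- by move=> _ [i _ <-]; exists (y i) => //; exists (X i) => //; case: (HX i).
have cP g i : c g i <-> dmap (y i) (X i) g^-1%g.
  have [AX E] := HX i; apply: (iff_trans (cE g i)).
  by rewrite E; exact: stone_act_base.
have B0 : B !=set0.
  apply/set0P/eqP => B0; move: Bk k0; rewrite B0 => /card_esym.
  by rewrite card_eq0; case: k => // k /eqP/(congr1 (@^~ 0)) /= <-.
exists h; apply/card1_image; first exact: ltrans_nonempty.
move=> _ _ [x Bx <-] [z Bz <-]; apply/ffunP => i; apply/idP/idP => /cP Hc;
  by apply/cP; move: Hc; apply: Hh => //; exists i.
Qed.

Lemma dmap_pt X : A X -> dmap (stone_pt A) X = X.
Proof.
move=> AX; apply/predeqP => g; rewrite /dmap /= ltransE invgK mulg1.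
by split=> [[]//|Xg]; split=> //; exact: galg_L (galgP A) _ _ AX.
Qed.

Lemma dsets_pt : dsets [set stone_pt A] = A.
Proof.
apply/predeqP => Y; split=> [[_ -> [X AX <-]]|AY]; first by rewrite dmap_pt.
by exists (stone_pt A) => //; exists Y => //; exact: dmap_pt.
Qed.

Let orbit := [set amb_act g (amb_pt (stone_ambit A)) | g in [set: G]].

Lemma pt_orbit : [set stone_pt A] `<=` orbit.
Proof. by move=> _ ->; exists 1%g => //; exact: stone_act1. Qed.

Definition rtrans (X : set G) (h : G) : set G := [set g | X (g * h)%g].

Lemma dmap_orbit h X : A X -> dmap (stone_act h (stone_pt A)) X = rtrans X h.
Proof.
move=> AX; apply/predeqP => g; rewrite /dmap /= -ltransM ltransE invgM !invgK mulg1.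
by split=> [[]//|Xg]; split=> //; exact: galg_L (galgP A) _ _ AX.
Qed.

(** For any P that contains p_e the family dsets P includes A, as
    d_{p_e}(X) = X, and d-closedness gives the reverse inclusion. *)
Lemma dclosed_DRP : dclosed A ->
  (WDRP (stone_ambit A) <-> DRP (stone_ambit A)) /\
  (DRP (stone_ambit A) <-> EDRP (stone_ambit A)).
Proof.
move=> dA; rewrite /WDRP /DRP /EDRP !DRP_dsetsP.
have PA P : [set stone_pt A] `<=` P -> dsets P = A.
  move=> /dsetsS; rewrite dsets_pt => AP.
  apply/predeqP => Y; split=> [[p _ [X AX <-]]|/AP//].
  exact: dA (stoneP p) _ AX.
by rewrite !PA //; exact: pt_orbit.
Qed.

Lemma rtrans_DRP : (forall X h, A X -> A (rtrans X h)) ->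
  WDRP (stone_ambit A) <-> DRP (stone_ambit A).
Proof.
move=> rA; rewrite /WDRP /DRP !DRP_dsetsP dsets_pt -/orbit.
suff -> : dsets orbit = A by [].
apply/predeqP => Y; split=> [[_ [h _ <-] [X AX <-]]|].
  by rewrite dmap_orbit //; exact: rA.
by rewrite -{1}dsets_pt; apply: dsetsS; exact: pt_orbit.
Qed.

End Stone.

(** * The d-closure *)

Section DClosure.
Variable G : groupType.
Implicit Types (A : galgebra G) (p : set_system G) (X Y : set G) (g h : G).

Lemma dmapC A p X : is_ultrafilter A p -> A X -> dmap p (~` X) = ~` dmap p X.
Proof.
move=> Hp AX; apply/predeqP => g; rewrite /dmap /setC /= ltransC.
exact: (stoneC (Stone Hp) (galg_L (galgP A) g^-1%g AX)).
Qed.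

Lemma dmapI A p X Y : is_ultrafilter A p -> A X -> A Y ->
  dmap p (X `&` Y) = dmap p X `&` dmap p Y.
Proof.
move=> Hp AX AY; apply/predeqP => g; rewrite /dmap /setI /= ltransI.
have AgX := galg_L (galgP A) g^-1%g AX; have AgY := galg_L (galgP A) g^-1%g AY.
split=> [pXY|[]]; last exact: (ultra_I Hp).
by split; apply: (ultra_up Hp pXY) => // x [].
Qed.

Lemma dmapT A p : is_ultrafilter A p -> dmap p setT = setT.
Proof.
move=> Hp; apply/predeqP => g; rewrite /dmap /= ltransT; split=> // _.
exact: ultra_T Hp.
Qed.

Lemma dmap_ltrans p g X : dmap p (ltrans g X) = ltrans g (dmap p X).
Proof.
by apply/predeqP => h; rewrite ltransE /dmap /= -ltransM invgM invgK.
Qed.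

Lemma ultrafilter_extension A p : is_ultrafilter A p ->
  exists2 U : set_system G, UltraFilter U & forall X, A X -> p X <-> U X.
Proof.
move=> Hp.
have pF : ProperFilter (filter_from p id).
  apply: filter_from_proper.
    apply: filter_from_filter; first by exists setT; exact: ultra_T Hp.
    by move=> Y Z pY pZ; exists (Y `&` Z) => //; exact: ultra_I Hp _ _ pY pZ.
  by move=> Y pY; apply/set0P/eqP => Y0; apply: (ultra_0 Hp); rewrite -Y0.
have [U [UU pU]] := ultraFilterLemma pF; exists U => // X AX.
have pUX Y : p Y -> U Y by move=> pY; apply: pU; exists Y.
split=> [/pUX//|UX]; have [//|/pUX UC] := ultra_or Hp AX.
have UF : ProperFilter U := ultra_proper.
by case: (@filter_not_empty _ U); rewrite -(setICr X); exact: filterI.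
Qed.

Lemma ultrafilter_restriction (A : galgebra G) (U : set_system G) :
  UltraFilter U -> is_ultrafilter A (galg_sets A `&` U).
Proof.
move=> UU; have UF : ProperFilter U := ultra_proper; have HA := galgP A.
split.
- by move=> Y [].
- by split; [exact: galg_T HA|exact: filterT].
- by move=> [_]; exact: filter_not_empty.
- by move=> Y Z [AY UY] [AZ UZ]; split; [exact: galg_I HA _ _ AY AZ|exact: filterI].
- by move=> Y Z [AY UY] AZ YZ; split=> //; exact: filterS UY.
- move=> Y AY; have [UY|UY] := in_ultra_setVsetC Y UU; [by left|right].
  by split=> //; exact: galg_C HA _ AY.
Qed.

Variable A : galgebra G.
Let F : set_system G := dsets [set: stone A].

Lemma boolgen_dsets_galgebra : is_galgebra (boolgen F).
Proof.
split; [exact: boolgenT|exact: boolgenC|exact: boolgenI|].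
move=> g X; elim=> {X} [X [p _ [Y AY <-]]||X _|X Y _ IX _ IY].
- rewrite -dmap_ltrans; apply: boolgen_in; exists p => //.
  by exists (ltrans g Y) => //; exact: galg_L (galgP A) _ _ AY.
- by rewrite ltransT; exact: boolgenT.
- by rewrite ltransC; exact: boolgenC.
- by rewrite ltransI; exact: boolgenI.
Qed.

(** d_q is a Boolean homomorphism, which reduces the claim to the generators,
    and d_q(d_p(X)) = d_r(X) for the ultrafilter r = {Y in A : d_p(Y) in q}. *)
Lemma boolgen_dsets_dclosed : dclosed (boolgen F).
Proof.
move=> q; pose B := GAlgebra boolgen_dsets_galgebra => Hq'.
have Hq : is_ultrafilter B q := Hq'.
have Bd p X : is_ultrafilter A p -> A X -> B (dmap p X).
  by move=> Hp AX; apply: boolgen_in; exists (Stone Hp) => //; exists X.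
move=> X; elim=> {X} [_ [p _ [X AX <-]]||X BX IX|X Y BX IX BY IY].
- have Hp := stoneP p.
  have Hr : is_ultrafilter A [set Y | A Y /\ q (dmap p Y)].
    split=> /=.
    + by move=> Y [].
    + by split; [exact: galg_T (galgP A)|rewrite (dmapT Hp); exact: ultra_T Hq].
    + move=> [_ q0]; apply: (ultra_0 Hq); rewrite -setCT -(dmapT Hp).
      by rewrite -(dmapC Hp (galg_T (galgP A))) setCT.
    + move=> Y Z [AY qY] [AZ qZ]; split; first exact: galg_I (galgP A) _ _ AY AZ.
      by rewrite (dmapI Hp) //; exact: (ultra_I Hq).
    + move=> Y Z [AY qY] AZ YZ; split=> //; apply: (ultra_up Hq qY) => [|g pgY].
        exact: Bd.
      apply: (ultra_up Hp pgY); first exact: galg_L (galgP A) _ _ AZ.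
      exact: ltransS.
    + move=> Y AY; rewrite (dmapC Hp) //.
      have [|] := ultra_or Hq (Bd _ _ Hp AY); [by left|right].
      by split=> //; exact: galg_C (galgP A) _ AY.
  suff -> : dmap q (dmap p X) = dmap [set Y | A Y /\ q (dmap p Y)] X by exact: Bd.
  apply/predeqP => g; rewrite /dmap /= -/(dmap p X) -dmap_ltrans.
  by split=> [qX|[]//]; split=> //; exact: galg_L (galgP A) _ _ AX.
- by rewrite (dmapT Hq); exact: boolgenT.
- by rewrite (dmapC Hq BX); exact: boolgenC.
- by rewrite (dmapI Hq BX BY); exact: boolgenI.
Qed.

Lemma dclosure_boolgen : dclosure A = boolgen F :> set_system G.
Proof.
apply/predeqP => Y; split=> [HY|].
  apply: HY; split; first split.
  - exact: boolgen_dsets_galgebra.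
  - exact: boolgen_dsets_dclosed.
  - move=> X AX; apply: boolgen_in.
    have : dsets [set stone_pt A] X by rewrite dsets_pt.
    exact: dsetsS.
have HD := dclosure_galgebra A.
have AD : galg_sets A `<=` dclosure A by exact: sub_gen_smallest.
elim=> {Y} [_ [p _ [X AX <-]]||X _|X Z _ + _].
- have [U UU pU] := ultrafilter_extension (stoneP p).
  suff -> : dmap p X = dmap (galg_sets (dclosure A) `&` U) X.
    by apply: (dclosure_dclosed (ultrafilter_restriction (dclosure A) UU)) (AD _ AX).
  apply/predeqP => g; have AgX := galg_L (galgP A) g^-1%g AX.
  split=> [/(pU _ AgX) UX|[_ UX]]; last exact/(pU _ AgX).
  by split=> //; exact: AD.
- exact: galg_T HD.
- exact: galg_C HD _.
- exact: galg_I HD _ _.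
Qed.

Lemma EDRP_dclosure :
  EDRP (stone_ambit A) <-> EDRP (stone_ambit (dclosure A)).
Proof.
have [WD DE] := @dclosed_DRP _ (dclosure A) (@dclosure_dclosed _ A).
rewrite -DE -WD /WDRP /EDRP !DRP_dsetsP dsets_pt dclosure_boolgen -/F.
split; first exact: homogeneous_boolgen.
by apply: homogeneousS => Y; exact: boolgen_in.
Qed.

End DClosure.

(** * Definable groups in elementary extensions *)

Section DefinableGroup.
Variables (L : language) (M : structure L) (G : definable_group M).
Let n := dg_dim G.

(** The graph of multiplication of G, read in an elementary extension N, is
    single-valued at points of G, since M satisfies for each k the formula that
    excludes a product whose k-th coordinate differs from that of g h. *)
Lemma dg_mul_elementary : exists (mu : formula L) (w : nat -> M),
  forall (N : structure L) (j : M -> N), elementary j ->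
  forall (g h : G) (y : n.-tuple N),
    sat (env (map j (dg_val g)) (env (map j (dg_val h)) (env y (j \o w)))) mu
      <-> y = map_tuple j (dg_val (g * h)%g).
Proof.
have [mu [w muE]] := dg_mul G; exists mu, w => N j ej g h y.
have vI (x z : G) : dg_val x = dg_val z :> seq M -> x = z.
  by move=> E; apply: (@dg_inj _ _ G); exact: val_inj.
have muP (z : n.-tuple M) :
    sat (env (dg_val g) (env (dg_val h) (env z w))) mu <-> z = dg_val (g * h)%g.
  have := congr1 (fun S => S [tuple of dg_val g ++ dg_val h ++ z]) muE.
  rewrite /= !env_cat => <-; split=> [[x _ [x' _]]|->]; last first.
    by exists g => //; exists h.
  move=> /(congr1 (@tval _ _)) /= /cat_inj.
  rewrite !size_tuple => -[]// /vI -> /cat_inj.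
  by rewrite !size_tuple => -[]// /vI -> /val_inj.
split=> [Hy|->]; last by rewrite /= !map_env; apply/ej/muP.
apply: eq_from_tnth => k; apply: contrapT => ny.
pose c := dg_val (g * h)%g.
(* chi is evaluated at the blocks y, g, h, c of n variables, mu at g, h, y *)
pose r i := if i < n then n + i else if i < n + n then n + i
  else if i < n + n + n then i - (n + n) else n + i.
pose chi := Fexn n (Fand (fren r mu) (Fnot (Feq (Var k) (Var (n + n + n + k))))).
have rE T (t1 t2 t3 t4 : n.-tuple T) (u : nat -> T) :
    env t3 (env t1 (env t2 (env t4 u))) \o r = env t1 (env t2 (env t3 u)).
  apply/funext => i; rewrite /r /=.
  have [i1|i1] := ltnP i n.
    rewrite envt_ge; last lia.
    by rewrite addKn; exact: envt_lt.
  rewrite [RHS]envt_ge//.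
  have [i2|i2] := ltnP i (n + n).
    do 2 (rewrite envt_ge; last lia).
    by rewrite addKn; apply: envt_lt; lia.
  rewrite [RHS]envt_ge; last lia.
  have [i3|i3] := ltnP i (n + n + n).
    by rewrite (_ : i - (n + n) = i - n - n); [apply: envt_lt; lia|lia].
  do 4 (rewrite envt_ge; last lia).
  rewrite [RHS]envt_ge; last lia.
  congr u; lia.
have cE T (t1 t2 t3 t4 : n.-tuple T) (u : nat -> T) :
    env t3 (env t1 (env t2 (env t4 u))) (n + n + n + k) = tnth t4 k.
  do 3 (rewrite envt_ge; last lia).
  rewrite (_ : n + n + n + k - n - n - n = k); last lia.
  exact: envt_nth.
have yE T (t : n.-tuple T) (u : nat -> T) : env t u k = tnth t k.
  exact: envt_nth.
have : sat (j \o env (dg_val g) (env (dg_val h) (env c w))) chi.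
  apply/sat_exn; exists y; apply/sat_and; rewrite sat_ren -!map_env.
  rewrite (rE _ (map_tuple j _) (map_tuple j _) y (map_tuple j _)); split=> //.
  by rewrite sat_not /= yE (cE _ (map_tuple j _) (map_tuple j _) y (map_tuple j _)).
move/ej/sat_exn => [z /sat_and[]]; rewrite sat_ren rE sat_not /= yE cE => /muP ->.
exact.
Qed.

(** The formula psi and the parameters w are the same for all g and h, so that
    h can be turned into a parameter, leaving a definable condition on g.
    [Def_rtrans] does this with a fixed h, [Ext_dclosed] with the class of the
    sequence of all h in an ultrapower. *)
Lemma dg_formula_mul (phi : formula L) : exists (psi : formula L) (w : nat -> M),
  forall (N : structure L) (j : M -> N), elementary j ->
  forall (b : nat -> N) (g h : G),
    sat (env (map j (dg_val g)) (env (map j (dg_val h)) (ilv (j \o w) b))) psi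
      <-> sat (env (map j (dg_val (g * h)%g)) b) phi.
Proof.
have [mu [w muP]] := dg_mul_elementary.
(* the blocks of variables are y, x, z, followed by the parameters; [rm] selects
   them in the order x, z, y of [mu] with the parameters w at the even places, [rp]
   selects y with the parameters b at the odd places *)
pose rm i := if i < n then n + i else if i < n + n then n + i
  else if i < n + n + n then i - (n + n) else n + n + n + (i - (n + n + n)).*2.
pose rp i := if i < n then i else n + n + n + (i - n).*2.+1.
exists (Fexn n (Fand (fren rm mu) (fren rp phi))), w => N j ej b g h.
pose x := map_tuple j (dg_val g); pose z := map_tuple j (dg_val h).
have rmE (y : n.-tuple N) : env y (env x (env z (ilv (j \o w) b))) \o rm
    = env x (env z (env y (j \o w))).
  apply/funext => i; rewrite /rm /=.
  have [i1|i1] := ltnP i n.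
    rewrite envt_ge; last lia.
    by rewrite addKn; exact: (envt_lt x).
  rewrite [RHS](envt_ge x)//.
  have [i2|i2] := ltnP i (n + n).
    rewrite envt_ge; last lia.
    rewrite (envt_ge x); last by rewrite -/n; lia.
    by rewrite addKn; apply: (envt_lt z); rewrite -/n; lia.
  rewrite [RHS](envt_ge z); last by rewrite -/n; lia.
  have [i3|i3] := ltnP i (n + n + n).
    by rewrite (_ : i - (n + n) = i - n - n); [apply: envt_lt; lia|lia].
  rewrite [RHS]envt_ge; last lia.
  rewrite envt_ge; last lia.
  rewrite (envt_ge x); last by rewrite -/n; lia.
  rewrite (envt_ge z); last by rewrite -/n; lia.
  rewrite (_ : _ - dg_dim G - _ = (i - (n + n + n)).*2); last by rewrite -/n; lia.
  by rewrite ilv_even; congr (j (w _)); rewrite -/n; lia.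
have rpE (y : n.-tuple N) : env y (env x (env z (ilv (j \o w) b))) \o rp = env y b.
  apply/funext => i; rewrite /rp /=.
  have [i1|i1] := ltnP i n; first exact: envt_lt.
  rewrite [RHS]envt_ge// envt_ge; last lia.
  rewrite (envt_ge x); last by rewrite -/n; lia.
  rewrite (envt_ge z); last by rewrite -/n; lia.
  rewrite (_ : _ - dg_dim G - _ = (i - n).*2.+1); last by rewrite -/n; lia.
  by rewrite ilv_odd.
apply: (iff_trans (sat_exn _ _ _)); split=> [[y]|H].
  by rewrite sat_and !sat_ren rmE rpE => -[/(muP _ _ ej) -> ].
exists (map_tuple j (dg_val (g * h)%g)).
by rewrite sat_and !sat_ren rmE rpE; split=> //; exact/(muP _ _ ej).
Qed.

Lemma Def_rtrans (X : set G) h : Def_sets X -> Def_sets (rtrans X h).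
Proof.
move=> /Def_setsP[D [phi [b ->]] ->]; have [psi [w psiP]] := dg_formula_mul phi.
apply/Def_setsP; exists [set x | sat (env x (env (dg_val h) (ilv w b))) psi].
  by eexists; exists (env (dg_val h) (ilv w b)).
apply/predeqP => g; rewrite /trace /rtrans /=.
by have := psiP _ _ (@id_elementary _ M) b g h; rewrite !map_id => ->.
Qed.

(** The parameters of the formula that defines d_p(X) are sequences indexed by
    x in G: the coordinates of x itself, whose class realizes p in the
    ultrapower, and constants. *)
Lemma Ext_dclosed : dclosed (Ext_alg G).
Proof.
move=> p Hp X EX; have [U UU pU] := ultrafilter_extension Hp.
have UF : ProperFilter U by exact: ultra_proper.
have [N [j [_ [ej [phi [b ->]] XE]]]] := EX.
have [psi [w psiP]] := dg_formula_mul phi.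
pose c k (x : G) := env (map j (dg_val x)) (ilv (j \o w) b) k.
pose V : structure L := upower N U.
pose d : N -> V := udiag (M := N) U.
exists V, (d \o j), [set t | sat (env t (ucl (M := N) U \o c)) psi]; split.
- by move=> chi v; apply: (iff_trans (ej chi v)); exact: (udiag_elementary UU).
- by eexists; exists (ucl (M := N) U \o c).
apply/predeqP => g; rewrite /dmap /trace /=.
have -> : env (map (d \o j) (dg_val g)) (ucl (M := N) U \o c)
    = ucl (M := N) U \o (fun k x => env (map j (dg_val g)) (c^~ x) k).
  apply/funext => k; rewrite /= map_comp.
  have [kn|nk] := ltnP k (size (map j (dg_val g))); last first.
    rewrite env_ge ?size_map // -?(size_map j)//; congr ucl; apply/funext => x.
    by rewrite env_ge.
  rewrite /env (nth_map (j (w 0))) //; congr ucl; apply/funext => x.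
  exact: set_nth_default.
rewrite los; apply: (iff_trans (pU _ (galg_L (galgP (Ext_alg G)) g^-1%g EX))).
have E x : ltrans g^-1%g X x <-> sat (env (map j (dg_val g)) (c^~ x)) psi.
  by rewrite ltransE invgK XE; apply: iff_sym; exact: psiP.
by split; apply: filterS => x /E.
Qed.

End DefinableGroup.

Theorem corollary4p16 (L : language) (M : structure L) (G : definable_group M) :
  [/\ ((WDRP (stone_ambit (Ext_alg G)) <-> DRP (stone_ambit (Ext_alg G))) /\
       (DRP (stone_ambit (Ext_alg G)) <-> EDRP (stone_ambit (Ext_alg G)))) /\
      ((WDRP (stone_ambit (dclosure (Def_alg G))) <->
          DRP (stone_ambit (dclosure (Def_alg G)))) /\
       (DRP (stone_ambit (dclosure (Def_alg G))) <->
          EDRP (stone_ambit (dclosure (Def_alg G))))),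
      WDRP (stone_ambit (Def_alg G)) <-> DRP (stone_ambit (Def_alg G)) &
      EDRP (stone_ambit (Def_alg G)) <->
        EDRP (stone_ambit (dclosure (Def_alg G)))].
Proof.
split; first split.
- exact: (dclosed_DRP (@Ext_dclosed _ _ G)).
- exact: (@dclosed_DRP _ (dclosure (Def_alg G)) (@dclosure_dclosed _ (Def_alg G))).
- by apply: rtrans_DRP => X h; exact: Def_rtrans.
- exact: EDRP_dclosure.
Qed.
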